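(* There exist constants $C_n$ ($n\ge2$), depending only on $n$, with $C_n\le2^{5/3}$ for all $n\ge2$ and $C_n\to4/e$ as $n\to\infty$, such that the following holds. Let $n\ge2$ be an integer, let $a<b$ be real, and suppose that $f:(a,b)\to\mathbb{R}$ is $n$ times differentiable and $|f^{(n)}(x)|\ge\lambda>0$ for all $x\in(a,b)$. Then $$ \left|\int_a^b e^{if(x)}\,dx\right|\le C_n\frac{n}{\lambda^{1/n}}. $$
   Context: $f^{(n)}$ denotes the $n$th derivative, which is not assumed to be continuous. The constants $C_n$ do not depend on $f$, $a$, $b$ or $\lambda$. *)

(* Defs.v *)
From Stdlib Require Import Reals.
From Coquelicot Require Import Coquelicot.

Open Scope R_scope.

Definition Cexp (z : C) : C :=
  (exp (Re z) * cos (Im z), exp (Re z) * sin (Im z)).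

(* [ex_derive_n f n x] alone only says that the total function
   [Derive_n f (n - 1)] is differentiable at [x]; all orders up to [n] are
   required so that each [Derive_n f k] is the true k-th derivative on (a,b).
   Derivatives at points of (a,b) do not depend on [f] outside (a,b). *)
Definition n_times_differentiable_on (n : nat) (f : R -> R) (a b : R) : Prop :=
  forall (k : nat) (x : R), (k <= n)%nat -> a < x < b -> ex_derive_n f k x.

(* The function t |-> e^{i f(t)}, with values in C viewed as a complete normed
   module over the reals (the structure needed by [RInt]). *)
Definition osc (f : R -> R) : R -> C_R_CompleteNormedModule :=
  fun t => Cexp (Ci * RtoC (f t))%C.

(* Main.v *)
(** By Lagrange interpolation at Chebyshev extremal points, transplanted into the
    set [|f'| <= al] by an expanding map, that set has measure at most
    [((n-1)! 2^(2n-3) al / lambda)^(1/(n-1))].  Off it, [f'] is monotone on at most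
    [2 (n-1)] intervals by Rolle's theorem, each contributing at most [2 / al] to the
    integral.  Optimizing over [al] gives
    [C_n = (2^(2n-1) (n-1)! (n-1)^(2-n))^(1/n)], which equals [2^(5/3)] at [n = 3] and
    tends to [4/e] by Stirling's formula. *)

Require Import Defs.
From Stdlib Require Import Reals.
From Coquelicot Require Import Coquelicot.
From Stdlib Require Import Lra Lia Factorial IndefiniteDescription Classical Ranalysis5.
Open Scope R_scope.

(** * Divided differences *)

(** Since the top derivative may be discontinuous, for [n = 2] there is neither an integrable [f'']
    for integration by parts nor an intermediate value theorem to fix its sign. The mean value
    theorem applied to a corrected primitive replaces the former, Darboux's property the latter.
    Measure theory is avoided too: a set of measure at least [L] is represented by a map from
    [[0, L]] into it that never shrinks distances. Interpolation needs no more, since wider gaps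
    between nodes only lower the weights [1 / |prod (x_j - x_i)|]. Chebyshev extremal points make
    the sum of the weights as small as possible on [[0, L]]: the Chebyshev polynomial is bounded by
    1 there, so its leading coefficient is a lower bound for that sum at any nodes, and alternation
    of signs gives equality at these. Finally, the modulus of the integral is reached through its
    real components in all unit directions, so that nothing is lost in passing from real to complex
    values. *)

Definition chain (F : nat -> R -> R) (n : nat) (a b : R) : Prop :=
  forall (k : nat) (x : R), (k < n)%nat -> a < x < b ->
    is_derive (F k) x (F (S k) x).

Lemma mvt (f df : R -> R) (u v : R) :
  u < v -> (forall x, u <= x <= v -> is_derive f x (df x)) ->
  exists c, u < c < v /\ f v - f u = df c * (v - u).
Proof.
  intros Huv Hd.
  destruct (MVT_cor2 f df u v Huv) as [c [Hc1 Hc2]].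
  - intros c Hc. apply is_derive_Reals, Hd, Hc.
  - exists c; split; assumption.
Qed.

Lemma increasing_lt (x : nat -> R) (m : nat) :
  (forall i, (i < m)%nat -> x i < x (S i)) ->
  forall i j, (i < j)%nat -> (j <= m)%nat -> x i < x j.
Proof.
  intros Hx i j Hij. induction Hij as [|j Hij IH]; intros Hj.
  - apply Hx; lia.
  - apply Rlt_trans with (x j); [apply IH; lia | apply Hx; lia].
Qed.

Lemma rolle_chain (m : nat) : forall (F : nat -> R -> R) (x : nat -> R) (a b : R),
  chain F m a b -> (forall i, (i < m)%nat -> x i < x (S i)) ->
  (forall i, (i <= m)%nat -> a < x i < b) ->
  (forall i, (i <= m)%nat -> F O (x i) = 0) ->
  exists z, a < z < b /\ F m z = 0.
Proof.
  induction m as [|m IH]; intros F x a b HF Hx Hab Hz.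
  - exists (x O); auto.
  (* The range condition stands inside the existential so that choice yields a total sequence; its
     values beyond [m] are junk. *)
  - assert (HR : forall i, exists y, (i <= m)%nat -> x i < y < x (S i) /\ F 1%nat y = 0).
    { intros i. destruct (Compare_dec.le_lt_dec i m) as [Hi|Hi]; [|exists 0; lia].
      destruct (mvt (F O) (F 1%nat) (x i) (x (S i))) as [c [Hc He]].
      - apply Hx; lia.
      - intros t Ht. apply HF; [lia|].
        destruct (Hab i), (Hab (S i)); try lia; lra.
      - exists c. intros _. split; [exact Hc|].
        rewrite !Hz in He by lia.
        apply Rmult_eq_reg_r with (x (S i) - x i); [lra|].
        assert (x i < x (S i)) by (apply Hx; lia). lra. }
    apply functional_choice in HR. destruct HR as [y Hy].
    apply (IH (fun k => F (S k)) y a b).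
    + intros k t Hk Ht. apply HF; [lia|exact Ht].
    + intros i Hi. destruct (Hy i), (Hy (S i)); try lia. lra.
    + intros i Hi. destruct (Hy i Hi) as [H _], (Hab i), (Hab (S i)); try lia; lra.
    + intros i Hi. apply Hy, Hi.
Qed.

(** * Polynomials through their constant derivatives *)

Lemma is_derive_of_constant (f f' : R -> R) (c : R) :
  (forall x, is_derive f x (f' x)) -> (forall x, f x = c) -> forall x, f' x = 0.
Proof.
  intros Hd Hc x. rewrite <- (is_derive_unique _ _ _ (Hd x)).
  rewrite (Derive_ext f (fun _ => c)) by exact Hc. apply Derive_const.
Qed.

(** Stands for a polynomial of degree at most [m] whose coefficient of degree [m] is [c / m!].
    Carrying the tower of derivatives lets it be subtracted from a [chain] directly. *)
Definition nth_derivative_const (m : nat) (c : R) (p : R -> R) : Prop :=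
  exists F : nat -> R -> R, (forall x, F O x = p x) /\
    (forall k x, is_derive (F k) x (F (S k) x)) /\ (forall x, F m x = c).

Lemma nth_derivative_const_cst (c : R) : nth_derivative_const 0 c (fun _ => c).
Proof.
  exists (fun k _ => match k with O => c | _ => 0 end).
  split; [reflexivity|split; [|reflexivity]]. intros [|k] x; apply is_derive_Reals, derivable_pt_lim_const.
Qed.

Lemma nth_derivative_const_comb (m : nat) (c c' u v : R) (p p' : R -> R) :
  nth_derivative_const m c p -> nth_derivative_const m c' p' ->
  nth_derivative_const m (u * c + v * c') (fun x => u * p x + v * p' x).
Proof.
  intros [F [F0 [F1 Fm]]] [G [G0 [G1 Gm]]].
  exists (fun k x => u * F k x + v * G k x). split; [|split].
  - intros x. now rewrite F0, G0.
  - intros k x.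
    apply (is_derive_plus (fun x => u * F k x) (fun x => v * G k x));
      apply is_derive_scal; auto.
  - intros x. now rewrite Fm, Gm.
Qed.

Lemma nth_derivative_const_linear (m : nat) (c d e : R) (p : R -> R) :
  nth_derivative_const m c p ->
  nth_derivative_const (S m) (INR (S m) * d * c) (fun x => (d * x + e) * p x).
Proof.
  intros [F [F0 [F1 Fm]]].
  assert (FS : forall x, F (S m) x = 0).
  { now apply is_derive_of_constant with (F m) c. }
  (* Leibniz's rule with a linear factor. At [k = 0] the index [pred 0] is harmless because of the
     factor [INR 0]; at [k = S m] the first term vanishes with [F (S m)]. *)
  exists (fun k x => (d * x + e) * F k x + INR k * d * F (pred k) x).
  split; [|split].
  - intros x. simpl. rewrite F0. ring.
  - intros k x.
    assert (H : is_derive (fun x => (d * x + e) * F k x) x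
              (d * F k x + (d * x + e) * F (S k) x)).
    { apply (is_derive_mult (fun x => d * x + e) (F k) x d (F (S k) x)).
      - auto_derive; [trivial|ring].
      - apply F1.
      - intros; apply Rmult_comm. }
    replace (Rplus _ _) with
      (plus (d * F k x + (d * x + e) * F (S k) x) (INR k * d * F k x)).
    2:{ unfold plus; simpl Nat.pred. rewrite S_INR. simpl. ring. }
    apply (is_derive_plus (fun x => (d * x + e) * F k x)); [exact H|].
    destruct k as [|k].
    + simpl INR. apply is_derive_ext with (fun _ => 0).
      { intros t. now rewrite !Rmult_0_l. }
      rewrite !Rmult_0_l. apply is_derive_Reals, derivable_pt_lim_const.
    + apply is_derive_scal. apply F1.
  - intros x. rewrite FS. simpl Nat.pred. rewrite Fm. ring.
Qed.

Lemma nth_derivative_const_succ (m : nat) (c : R) (p : R -> R) :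
  nth_derivative_const m c p -> nth_derivative_const (S m) 0 p.
Proof.
  intros [F [F0 [F1 Fm]]]. exists F. split; [exact F0|split; [exact F1|]].
  now apply is_derive_of_constant with (F m) c.
Qed.

Lemma nth_derivative_const_ext (m : nat) (c c' : R) (p p' : R -> R) :
  c = c' -> (forall x, p x = p' x) ->
  nth_derivative_const m c p -> nth_derivative_const m c' p'.
Proof.
  intros -> Hp [F [F0 HF]]. exists F; split; [|exact HF].
  intros x; now rewrite F0.
Qed.

(** For [j < n] this is the numerator of a Lagrange basis polynomial, monic of degree [n - 1]; for
    [n <= j] no factor is skipped and the degree is [n]. *)
Fixpoint node_prod (x : nat -> R) (j n : nat) (y : R) : R :=
  match n with
  | O => 1
  | S i => (if Nat.eqb i j then 1 else y - x i) * node_prod x j i y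
  end.

Lemma node_prod_node (x : nat -> R) (j n k : nat) :
  (k < n)%nat -> k <> j -> node_prod x j n (x k) = 0.
Proof.
  intros Hk Hj. induction n as [|n IH]; [lia|]. simpl.
  destruct (Nat.eq_dec k n) as [->|Hn].
  - rewrite (proj2 (Nat.eqb_neq n j) Hj). ring.
  - rewrite IH by lia. ring.
Qed.

Lemma node_prod_neq_0 (x : nat -> R) (j n : nat) (y : R) :
  (forall i, (i < n)%nat -> i <> j -> y <> x i) -> node_prod x j n y <> 0.
Proof.
  induction n as [|n IH]; intros Hy; simpl; [lra|].
  apply Rmult_integral_contrapositive_currified.
  - destruct (Nat.eqb_spec n j) as [|Hn]; [lra|].
    assert (y <> x n) by (apply Hy; lia). lra.
  - apply IH. intros i Hi. apply Hy; lia.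
Qed.

Lemma node_prod_derivative_le (x : nat -> R) (j n : nat) : (n <= j)%nat ->
  nth_derivative_const n (INR (fact n)) (node_prod x j n).
Proof.
  induction n as [|n IH]; intros Hn.
  - apply nth_derivative_const_cst.
  - eapply nth_derivative_const_ext;
      [| |apply (nth_derivative_const_linear n (INR (fact n)) 1 (- x n)), IH; lia].
    + rewrite fact_simpl, mult_INR. ring.
    + intros y. simpl. destruct (Nat.eqb_spec n j); [lia|].
      unfold Rminus. now rewrite Rmult_1_l.
Qed.

Lemma node_prod_derivative (x : nat -> R) (j n : nat) : (j <= n)%nat ->
  nth_derivative_const n (INR (fact n)) (node_prod x j (S n)).
Proof.
  induction n as [|n IH]; intros Hn.
  - replace j with O by lia.
    apply (nth_derivative_const_ext 0 1 _ (fun _ => 1)); [reflexivity| |apply nth_derivative_const_cst].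
    intros y. simpl. ring.
  - destruct (Nat.eq_dec j (S n)) as [->|Hj].
    + apply (nth_derivative_const_ext (S n) (INR (fact (S n))) _ (node_prod x (S n) (S n)));
        [reflexivity| |apply node_prod_derivative_le; lia].
      intros y. change (node_prod x (S n) (S n) y =
        (if Nat.eqb (S n) (S n) then 1 else y - x (S n)) * node_prod x (S n) (S n) y).
      rewrite Nat.eqb_refl. ring.
    + eapply nth_derivative_const_ext;
        [| |apply (nth_derivative_const_linear n (INR (fact n)) 1 (- x (S n))), IH; lia].
      * rewrite (fact_simpl n), mult_INR. ring.
      * intros y. change (node_prod x j (S (S n)) y) with
        ((if Nat.eqb (S n) j then 1 else y - x (S n)) * node_prod x j (S n) y).
        destruct (Nat.eqb_spec (S n) j); [lia|].
        unfold Rminus. now rewrite Rmult_1_l.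
Qed.

(** The coefficient of degree [m] in the Lagrange interpolant of [g] at the nodes. *)
Definition divided_difference (g : R -> R) (x : nat -> R) (m : nat) : R :=
  sum_f_R0 (fun j => g (x j) / node_prod x j (S m) (x j)) m.

Lemma nth_derivative_const_sum (m k : nat) (c : R) (w : nat -> R) (p : nat -> R -> R) :
  (forall j, (j <= k)%nat -> nth_derivative_const m c (p j)) ->
  nth_derivative_const m (sum_f_R0 w k * c) (fun y => sum_f_R0 (fun j => w j * p j y) k).
Proof.
  induction k as [|k IH]; intros Hp.
  - eapply nth_derivative_const_ext;
      [| |apply (nth_derivative_const_comb m c c (w O) 0 (p O) (p O)); apply Hp; lia].
    + simpl. ring.
    + intros y. simpl. ring.
  - eapply nth_derivative_const_ext;
      [| |apply (nth_derivative_const_comb m (sum_f_R0 w k * c) c 1 (w (S k))); [apply IH|apply (Hp (S k))]].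
    + simpl. ring.
    + intros y. simpl. ring.
    + intros j Hj. apply Hp; lia.
    + lia.
Qed.

Lemma sum_single (w : nat -> R) (m k : nat) : (k <= m)%nat ->
  (forall j, (j <= m)%nat -> j <> k -> w j = 0) -> sum_f_R0 w m = w k.
Proof.
  induction m as [|m IH]; intros Hk Hw.
  - now replace k with O by lia.
  - simpl. destruct (Nat.eq_dec k (S m)) as [->|Hn].
    + rewrite (sum_eq w (fun _ => 0)).
      * rewrite sum_cte. ring.
      * intros i Hi. apply Hw; lia.
    + rewrite IH; [|lia|intros; apply Hw; lia].
      rewrite (Hw (S m)) by lia. ring.
Qed.

(* Rolle's theorem applied to the error of Lagrange interpolation at the nodes. *)
Lemma divided_difference_mean_value (m : nat) (G : nat -> R -> R) (x : nat -> R) (a b : R) :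
  chain G m a b -> (forall i, (i < m)%nat -> x i < x (S i)) ->
  (forall i, (i <= m)%nat -> a < x i < b) ->
  exists z, a < z < b /\ divided_difference (G O) x m * INR (fact m) = G m z.
Proof.
  intros HG Hx Hab.
  set (w := fun j => G O (x j) / node_prod x j (S m) (x j)).
  destruct (nth_derivative_const_sum m m (INR (fact m)) w (fun j => node_prod x j (S m)))
    as [P [P0 [P1 Pm]]].
  { intros j Hj. now apply node_prod_derivative. }
  destruct (rolle_chain m (fun k y => G k y - P k y) x a b) as [z [Hz He]]; auto.
  - intros k y Hk Hy. apply (is_derive_minus (G k) (P k)); auto.
  - intros k Hk. rewrite P0, (sum_single _ m k Hk).
    + unfold w. field. apply node_prod_neq_0. intros i Hi Hik.
      destruct (Nat.lt_ge_cases i k) as [H|H].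
      * apply Rgt_not_eq, (increasing_lt x m); auto.
      * apply Rlt_not_eq, (increasing_lt x m); auto; lia.
    + intros j Hj Hjk. rewrite node_prod_node; [ring|lia|congruence].
  - exists z; split; [exact Hz|]. rewrite Pm in He.
    change (divided_difference (G O) x m) with (sum_f_R0 w m). lra.
Qed.

(** * Chebyshev nodes and the sublevel set estimate *)

Fixpoint chebyshev (n : nat) (y : R) : R :=
  match n with
  | O => 1
  | S k => match k with
           | O => y
           | S j => 2 * y * chebyshev k y - chebyshev j y
           end
  end.

Lemma chebyshev_SS (n : nat) (y : R) :
  chebyshev (S (S n)) y = 2 * y * chebyshev (S n) y - chebyshev n y.
Proof. reflexivity. Qed.

Lemma chebyshev_cos (n : nat) (t : R) : chebyshev n (cos t) = cos (INR n * t).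
Proof.
  enough (H : chebyshev n (cos t) = cos (INR n * t) /\
              chebyshev (S n) (cos t) = cos (INR (S n) * t)) by apply H.
  induction n as [|n [IH1 IH2]].
  - split.
    + simpl. rewrite Rmult_0_l. now rewrite cos_0.
    + simpl. now rewrite Rmult_1_l.
  - split; [exact IH2|].
    rewrite chebyshev_SS, IH1, IH2.
    replace (INR n * t) with (INR (S n) * t - t) by (rewrite S_INR; ring).
    replace (INR (S (S n)) * t) with (INR (S n) * t + t) by (rewrite !S_INR; ring).
    rewrite cos_plus, cos_minus. ring.
Qed.

(** The recurrence doubles the leading coefficient at each step from degree 1 on; degree 0 does not
    fit this pattern, hence the index [S n]. The subtracted polynomial has degree two less and
    disappears, which is why [step] accepts any [c]. *)
Lemma chebyshev_derivative (d e : R) (n : nat) :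
  nth_derivative_const (S n) (2 ^ n * d ^ S n * INR (fact (S n)))
    (fun y => chebyshev (S n) (d * y + e)).
Proof.
  enough (H : nth_derivative_const (S n) (2 ^ n * d ^ S n * INR (fact (S n)))
                (fun y => chebyshev (S n) (d * y + e)) /\
              nth_derivative_const (S (S n)) (2 ^ S n * d ^ S (S n) * INR (fact (S (S n))))
                (fun y => chebyshev (S (S n)) (d * y + e))) by apply H.
  assert (H1 : nth_derivative_const 1 (2 ^ 0 * d ^ 1 * INR (fact 1))
                (fun y => chebyshev 1 (d * y + e))).
  { eapply nth_derivative_const_ext;
      [| |apply (nth_derivative_const_linear 0 1 d e), nth_derivative_const_cst].
    - simpl. ring.
    - intros y. simpl. ring. }
  assert (step : forall k c, nth_derivative_const k c (fun y => chebyshev k (d * y + e)) ->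
    nth_derivative_const (S k) (2 ^ k * d ^ S k * INR (fact (S k)))
      (fun y => chebyshev (S k) (d * y + e)) ->
    nth_derivative_const (S (S k)) (2 ^ S k * d ^ S (S k) * INR (fact (S (S k))))
      (fun y => chebyshev (S (S k)) (d * y + e))).
  { intros k c Hk HSk.
    apply nth_derivative_const_succ, nth_derivative_const_succ in Hk.
    apply (nth_derivative_const_linear _ _ d e) in HSk.
    pose proof (nth_derivative_const_comb _ _ _ 2 (-1) _ _ HSk Hk) as H.
    revert H. apply nth_derivative_const_ext.
    - rewrite (fact_simpl (S k)), mult_INR, <- !tech_pow_Rmult. ring.
    - intros y. rewrite chebyshev_SS. ring. }
  induction n as [|n [IH1 IH2]].
  - split; [exact H1|].
    apply (step O 1); [exact (nth_derivative_const_cst 1)|exact H1].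
  - split; [exact IH2|]. exact (step (S n) _ IH1 IH2).
Qed.

Lemma cos_nat_PI (n : nat) : cos (INR n * PI) = (-1) ^ n.
Proof.
  induction n as [|n IH].
  - simpl. now rewrite Rmult_0_l, cos_0.
  - rewrite S_INR, Rmult_plus_distr_r, Rmult_1_l, neg_cos, IH. simpl. ring.
Qed.

(* The Chebyshev extremal points rescaled to [0, L]. *)
Definition chebyshev_node (m : nat) (L : R) (j : nat) : R :=
  L / 2 * (1 - cos (INR j * PI / INR m)).

Lemma chebyshev_node_range (m : nat) (L : R) (j : nat) :
  0 < L -> 0 <= chebyshev_node m L j <= L.
Proof.
  intros HL. unfold chebyshev_node.
  pose proof (COS_bound (INR j * PI / INR m)). split.
  - apply Rmult_le_pos; lra.
  - apply Rle_trans with (L / 2 * 2); [|lra]. apply Rmult_le_compat_l; lra.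
Qed.

Lemma chebyshev_node_increasing (m : nat) (L : R) (j : nat) :
  0 < L -> (j < m)%nat -> chebyshev_node m L j < chebyshev_node m L (S j).
Proof.
  intros HL Hj. unfold chebyshev_node.
  assert (Hm : 0 < INR m) by (apply lt_0_INR; lia).
  assert (Hj' : INR (S j) <= INR m) by (apply le_INR; lia).
  pose proof (pos_INR j) as Hj0. rewrite S_INR in *.
  pose proof PI_RGT_0 as HPI.
  apply Rmult_lt_compat_l; [lra|].
  enough (cos ((INR j + 1) * PI / INR m) < cos (INR j * PI / INR m)) by lra.
  assert (HP : forall r, 0 <= r <= INR m -> 0 <= r * PI / INR m <= PI).
  { intros r Hr. split.
    - apply Rmult_le_pos; [apply Rmult_le_pos; lra|]. left. now apply Rinv_0_lt_compat.
    - apply Rmult_le_reg_r with (INR m); [exact Hm|].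
      unfold Rdiv. rewrite Rmult_assoc, Rinv_l, Rmult_1_r by lra.
      rewrite (Rmult_comm PI). apply Rmult_le_compat_r; lra. }
  apply cos_decreasing_1; try apply HP; try lra.
  apply Rmult_lt_compat_r; [now apply Rinv_0_lt_compat|].
  apply Rmult_lt_compat_r; lra.
Qed.

(** The affine map sends node [j] to the cosine of [PI - j PI / m], and the multiple angle formula
    turns this into the cosine of [(m - j) PI]. *)
Lemma chebyshev_at_node (m : nat) (L : R) (j : nat) : 0 < L -> (j <= m)%nat -> (0 < m)%nat ->
  chebyshev m (2 / L * chebyshev_node m L j + -1) = (-1) ^ (m - j).
Proof.
  intros HL Hj Hm. assert (0 < INR m) by (apply lt_0_INR; lia).
  replace (2 / L * chebyshev_node m L j + -1) with (cos (PI - INR j * PI / INR m)).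
  - rewrite chebyshev_cos, <- cos_nat_PI, minus_INR by lia.
    f_equal. field. lra.
  - rewrite Rtrigo_facts.cos_pi_minus. unfold chebyshev_node. field. lra.
Qed.

(** Exactly the factors with [j < i < n] are negative. For [n <= j] the truncated exponent is 0 and
    all factors are positive. *)
Lemma node_prod_sign (x : nat -> R) (m j n : nat) :
  (forall i, (i < m)%nat -> x i < x (S i)) -> (j <= m)%nat -> (n <= S m)%nat ->
  0 < (-1) ^ (n - 1 - j) * node_prod x j n (x j).
Proof.
  intros Hx Hj. induction n as [|n IH]; intros Hn.
  - simpl. lra.
  - simpl node_prod. specialize (IH ltac:(lia)).
    replace (S n - 1 - j)%nat with (n - j)%nat by lia.
    destruct (Nat.eqb_spec n j) as [->|Hnj].
    + replace (j - j)%nat with (j - 1 - j)%nat by lia. now rewrite Rmult_1_l.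
    + destruct (Nat.lt_ge_cases n j) as [H|H].
      * replace (n - j)%nat with (n - 1 - j)%nat by lia.
        assert (x n < x j) by (apply (increasing_lt x m); auto).
        replace (_ * (_ * _)) with ((x j - x n) * ((-1) ^ (n - 1 - j) * node_prod x j n (x j))) by ring.
        apply Rmult_lt_0_compat; lra.
      * replace (n - j)%nat with (S (n - 1 - j)) by lia.
        assert (x j < x n) by (apply (increasing_lt x m); auto; lia).
        replace (_ * (_ * _)) with ((x n - x j) * ((-1) ^ (n - 1 - j) * node_prod x j n (x j)))
          by (simpl; ring).
        apply Rmult_lt_0_compat; lra.
Qed.

Lemma pow_m1_sqr (k : nat) : (-1) ^ k * (-1) ^ k = 1.
Proof.
  rewrite <- Rpow_mult_distr. replace (-1 * -1) with 1 by ring. apply pow1.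
Qed.

Lemma node_prod_abs (x : nat -> R) (m j : nat) :
  (forall i, (i < m)%nat -> x i < x (S i)) -> (j <= m)%nat ->
  Rabs (node_prod x j (S m) (x j)) = (-1) ^ (m - j) * node_prod x j (S m) (x j).
Proof.
  intros Hx Hj. pose proof (node_prod_sign x m j (S m) Hx Hj (Nat.le_refl _)) as H.
  replace (S m - 1 - j)%nat with (m - j)%nat in H by lia.
  rewrite <- (Rabs_pos_eq _ (Rlt_le _ _ H)), Rabs_mult, <- RPow_abs.
  rewrite Rabs_m1, pow1. now rewrite Rmult_1_l.
Qed.

(* The left-hand side is the divided difference of the Chebyshev polynomial,
   whose values alternate in sign exactly as the weights do. *)
Lemma chebyshev_node_weights (m : nat) (L : R) : 0 < L ->
  sum_f_R0 (fun j => / Rabs (node_prod (chebyshev_node (S m) L) j (S (S m))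
                               (chebyshev_node (S m) L j))) (S m)
  = 2 ^ m * (2 / L) ^ S m.
Proof.
  intros HL. set (s := chebyshev_node (S m) L).
  assert (Hs : forall i, (i < S m)%nat -> s i < s (S i)).
  { intros i Hi. now apply chebyshev_node_increasing. }
  destruct (chebyshev_derivative (2 / L) (-1) m) as [F [F0 [F1 Fm]]].
  (* Any open interval around [[0, L]] would do: the derivative of order [S m] is constant, so the
     intermediate point drops out. *)
  destruct (divided_difference_mean_value (S m) F s (-1) (L + 1)) as [z [_ Hz]]; auto.
  - intros k x _ _. apply F1.
  - intros i Hi. pose proof (chebyshev_node_range (S m) L i HL). fold s in H. lra.
  - rewrite Fm in Hz. apply Rmult_eq_reg_r in Hz; [|apply INR_fact_neq_0].
    rewrite <- Hz. unfold divided_difference. apply sum_eq. intros j Hj.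
    rewrite F0. unfold s at 3. rewrite chebyshev_at_node by (auto; lia).
    rewrite node_prod_abs by auto.
    pose proof (node_prod_sign s (S m) j (S (S m)) Hs Hj (Nat.le_refl _)) as Hsg.
    assert (node_prod s j (S (S m)) (s j) <> 0) by (intros E; rewrite E in Hsg; lra).
    assert ((-1) ^ (S m - j) <> 0) by (apply pow_nonzero; lra).
    transitivity ((-1) ^ (S m - j) * (-1) ^ (S m - j) /
                  ((-1) ^ (S m - j) * node_prod s j (S (S m)) (s j))).
    + rewrite pow_m1_sqr. unfold Rdiv. now rewrite Rmult_1_l.
    + field. split; assumption.
Qed.

Lemma node_prod_abs_le (x s : nat -> R) (m j n : nat) :
  (forall i, (i <= m)%nat -> Rabs (s j - s i) <= Rabs (x j - x i)) -> (n <= S m)%nat ->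
  Rabs (node_prod s j n (s j)) <= Rabs (node_prod x j n (x j)).
Proof.
  intros Hxs. induction n as [|n IH]; intros Hn; simpl; [lra|].
  rewrite !Rabs_mult. apply Rmult_le_compat; try apply Rabs_pos.
  - destruct (Nat.eqb n j); [lra|]. apply Hxs; lia.
  - apply IH; lia.
Qed.

(* [tau] plays the role of the inverse of the map sending [x] to the measure of
   [E] to the left of [x], where [E] is a set of measure [L] on which [|G 0| <= al]. *)
Lemma sublevel_estimate (m : nat) (G : nat -> R -> R) (tau : R -> R) (a b al lambda L : R) :
  chain G (S m) a b -> (forall x, a < x < b -> lambda <= Rabs (G (S m) x)) ->
  0 < L ->
  (forall s, 0 <= s <= L -> a < tau s < b /\ Rabs (G O (tau s)) <= al) ->
  (forall s t, 0 <= s -> s <= t -> t <= L -> t - s <= tau t - tau s) ->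
  lambda * L ^ S m <= al * INR (fact (S m)) * 2 ^ (2 * m + 1).
Proof.
  intros HG Hlam HL Htau Hexp.
  set (s := chebyshev_node (S m) L). set (x := fun j => tau (s j)).
  assert (Hs : forall i, (i < S m)%nat -> s i < s (S i)).
  { intros i Hi. now apply chebyshev_node_increasing. }
  assert (Hr : forall i, 0 <= s i <= L).
  { intros i. now apply chebyshev_node_range. }
  assert (Hx : forall i, (i < S m)%nat -> x i < x (S i)).
  { intros i Hi. specialize (Hs i Hi).
    pose proof (Hexp (s i) (s (S i)) (proj1 (Hr i)) (Rlt_le _ _ Hs) (proj2 (Hr (S i)))).
    unfold x. lra. }
  destruct (divided_difference_mean_value (S m) G x a b HG Hx) as [z [Hz He]].
  { intros i _. apply Htau, Hr. }
  (* Term by term: the value is at most [al], and since [tau] expands, each weight is at most its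
     Chebyshev counterpart. *)
  assert (Hd : Rabs (divided_difference (G O) x (S m)) <= al * (2 ^ m * (2 / L) ^ S m)).
  { unfold divided_difference. apply Rle_trans with (1 := Rsum_abs _ _).
    rewrite <- chebyshev_node_weights by exact HL. fold s. rewrite scal_sum.
    apply sum_Rle. intros j Hj. unfold Rdiv. rewrite Rabs_mult, Rabs_inv, Rmult_comm.
    assert (Hp : 0 < Rabs (node_prod s j (S (S m)) (s j))).
    { apply Rabs_pos_lt. intros E.
      pose proof (node_prod_sign s (S m) j (S (S m)) Hs Hj (Nat.le_refl _)) as H.
      rewrite E in H. lra. }
    assert (Hle : Rabs (node_prod s j (S (S m)) (s j)) <= Rabs (node_prod x j (S (S m)) (x j))).
    { apply (node_prod_abs_le x s (S m)); [|lia]. intros i Hi. unfold x.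
      destruct (Rle_lt_dec (s i) (s j)) as [H|H].
      - pose proof (Hexp (s i) (s j) (proj1 (Hr i)) H (proj2 (Hr j))).
        rewrite !Rabs_pos_eq; lra.
      - pose proof (Hexp (s j) (s i) (proj1 (Hr j)) (Rlt_le _ _ H) (proj2 (Hr i))).
        rewrite (Rabs_minus_sym (s j)), (Rabs_minus_sym (tau (s j))).
        rewrite !Rabs_pos_eq; lra. }
    apply Rmult_le_compat.
    - left. apply Rinv_0_lt_compat. lra.
    - apply Rabs_pos.
    - apply Rinv_le_contravar; assumption.
    - apply Htau, Hr. }
  specialize (Hlam z Hz). rewrite <- He, Rabs_mult in Hlam.
  rewrite (Rabs_pos_eq (INR _)) in Hlam by apply pos_INR.
  pose proof (INR_fact_lt_0 (S m)) as Hf.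
  assert (HLm : 0 < L ^ S m) by (now apply pow_lt).
  apply Rle_trans with (al * (2 ^ m * (2 / L) ^ S m) * INR (fact (S m)) * L ^ S m).
  - apply Rmult_le_compat_r; [lra|]. apply Rle_trans with (1 := Hlam).
    apply Rmult_le_compat_r; lra.
  - right. unfold Rdiv. rewrite Rpow_mult_distr, pow_inv.
    replace (2 * m + 1)%nat with (m + S m)%nat by lia. rewrite pow_add. field. lra.
Qed.

(** * Intervals of monotonicity and thick sets *)

(** As [h] need not be continuous, the zero is found at a minimum of [g]; the signs of [h] at [u]
    and [v] exclude the endpoints. *)
Lemma darboux_zero (g h : R -> R) (u v : R) :
  u < v -> (forall x, u <= x <= v -> is_derive g x (h x)) ->
  h u < 0 -> 0 < h v -> exists c, u < c < v /\ h c = 0.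
Proof.
  intros Huv Hd Hu Hv.
  assert (Hd' : forall x, u <= x <= v -> derivable_pt_lim g x (h x)).
  { intros x Hx. apply is_derive_Reals, Hd, Hx. }
  destruct (continuity_ab_min g u v) as [c [Hmin Hc]]; [lra| |].
  { intros x Hx. apply derivable_continuous_pt. exists (h x). now apply Hd'. }
  assert (Hcu : c <> u).
  { intros ->. destruct (Hd' u ltac:(lra) (- h u) ltac:(lra)) as [d Hdelta].
    set (k := Rmin (d / 2) (v - u)).
    pose proof (cond_pos d). pose proof (Rmin_l (d / 2) (v - u)).
    pose proof (Rmin_r (d / 2) (v - u)).
    assert (0 < k) by (apply Rmin_pos; lra). fold k in H0, H1.
    specialize (Hdelta k ltac:(lra)). rewrite Rabs_pos_eq in Hdelta by lra.
    specialize (Hdelta ltac:(lra)). apply Rabs_def2 in Hdelta.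
    specialize (Hmin (u + k) ltac:(lra)).
    assert (0 <= (g (u + k) - g u) / k).
    { apply Rmult_le_pos; [lra|]. left. now apply Rinv_0_lt_compat. }
    lra. }
  assert (Hcv : c <> v).
  { intros ->. destruct (Hd' v ltac:(lra) (h v) ltac:(lra)) as [d Hdelta].
    set (k := Rmin (d / 2) (v - u)).
    pose proof (cond_pos d). pose proof (Rmin_l (d / 2) (v - u)).
    pose proof (Rmin_r (d / 2) (v - u)).
    assert (0 < k) by (apply Rmin_pos; lra). fold k in H0, H1.
    specialize (Hdelta (- k) ltac:(lra)). rewrite Rabs_Ropp, Rabs_pos_eq in Hdelta by lra.
    specialize (Hdelta ltac:(lra)). apply Rabs_def2 in Hdelta.
    specialize (Hmin (v + - k) ltac:(lra)).
    assert (0 <= (g (v + - k) - g v) / k).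
    { apply Rmult_le_pos; [lra|]. left. now apply Rinv_0_lt_compat. }
    replace ((g (v + - k) - g v) / - k) with (- ((g (v + - k) - g v) / k)) in Hdelta
      by (field; lra). lra. }
  exists c. split; [lra|].
  assert (pr : derivable_pt g c) by (exists (h c); apply Hd'; lra).
  pose proof (deriv_minimum g u v c pr ltac:(lra) ltac:(lra)) as H.
  rewrite <- H; [|intros; apply Hmin; lra].
  symmetry. apply derive_pt_eq. apply Hd'. lra.
Qed.

Lemma derivative_sign (g h : R -> R) (u v : R) :
  (forall x, u <= x <= v -> is_derive g x (h x)) ->
  (forall x, u < x < v -> h x <> 0) ->
  (forall x, u < x < v -> 0 <= h x) \/ (forall x, u < x < v -> h x <= 0).
Proof.
  intros Hd Hn.
  destruct (classic (forall x, u < x < v -> 0 <= h x)) as [H|H]; [now left|right].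
  apply not_all_ex_not in H. destruct H as [x H]. apply imply_to_and in H.
  destruct H as [Hx Hhx]. intros y Hy. apply Rnot_lt_le. intros Hhy.
  destruct (Rtotal_order x y) as [L|[->|L]]; [|lra|].
  - destruct (darboux_zero g h x y L) as [c [Hc E]]; try lra.
    + intros t Ht. apply Hd. lra.
    + apply (Hn c); [lra|exact E].
  - destruct (darboux_zero (fun t => - g t) (fun t => - h t) y x L) as [c [Hc E]]; try lra.
    + intros t Ht. apply (is_derive_opp g). apply Hd. lra.
    + apply (Hn c); lra.
Qed.

(** Cut points are unconstrained: [h] may or may not vanish there. Counting pieces instead of zeros
    gives the number of monotonicity intervals of an antiderivative directly. *)
Inductive nonzero_pieces (h : R -> R) : nat -> R -> R -> Prop :=
| nonzero_pieces_one u v : u < v -> (forall x, u < x < v -> h x <> 0) ->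
    nonzero_pieces h 1 u v
| nonzero_pieces_cons r u w v : u < w -> (forall x, u < x < w -> h x <> 0) ->
    nonzero_pieces h r w v -> nonzero_pieces h (S r) u v.

Lemma nonzero_pieces_lt (h : R -> R) (r : nat) (u v : R) : nonzero_pieces h r u v -> u < v.
Proof. induction 1; lra. Qed.

Lemma nonzero_pieces_extend (h : R -> R) (r : nat) (u w v : R) :
  u < w -> (forall x, u < x <= w -> h x <> 0) ->
  nonzero_pieces h r w v -> nonzero_pieces h r u v.
Proof.
  intros Huw Hh Hp. destruct Hp as [w v Hwv Hn|r w y v Hwy Hn Hp].
  - constructor; [lra|]. intros x Hx.
    destruct (Rle_lt_dec x w); [apply Hh|apply Hn]; lra.
  - apply nonzero_pieces_cons with y; [lra| |exact Hp]. intros x Hx.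
    destruct (Rle_lt_dec x w); [apply Hh|apply Hn]; lra.
Qed.

(* By Rolle, [h] has at most one zero on each piece [(u, w]] of [h']. *)
Lemma nonzero_pieces_antiderivative (h h' : R -> R) (r : nat) (u v : R) :
  (forall x, u <= x <= v -> is_derive h x (h' x)) -> nonzero_pieces h' r u v ->
  exists r', (r' <= S r)%nat /\ nonzero_pieces h r' u v.
Proof.
  intros Hd Hp.
  assert (inj : forall u w, u < w -> (forall x, u <= x <= w -> is_derive h x (h' x)) ->
    (forall x, u < x < w -> h' x <> 0) ->
    forall x y, u < x -> x < y -> y <= w -> h x = 0 -> h y <> 0).
  { intros u1 w1 Hw Hd1 Hn x y Hx Hxy Hy Ex Ey.
    destruct (mvt h h' x y Hxy) as [c [Hc E]].
    - intros t Ht. apply Hd1. lra.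
    - rewrite Ex, Ey in E. apply (Hn c); [lra|].
      apply Rmult_eq_reg_r with (y - x); lra. }
  induction Hp as [u v Huv Hn|r u w v Huw Hn Hp IH].
  - destruct (classic (exists z, u < z < v /\ h z = 0)) as [[z [Hz Ez]]|H].
    + exists 2%nat. split; [lia|]. apply nonzero_pieces_cons with z; [lra| |].
      * intros x Hx Ex. exact (inj u v Huv Hd Hn x z ltac:(lra) ltac:(lra) ltac:(lra) Ex Ez).
      * apply nonzero_pieces_one; [lra|]. intros x Hx.
        exact (inj u v Huv Hd Hn z x ltac:(lra) ltac:(lra) ltac:(lra) Ez).
    + exists 1%nat. split; [lia|]. apply nonzero_pieces_one; [lra|].
      intros x Hx Ex. apply H. exists x. split; assumption.
  - pose proof (nonzero_pieces_lt _ _ _ _ Hp) as Hwv.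
    destruct IH as [r' [Hr' Hp']].
    { intros x Hx. apply Hd. lra. }
    assert (Hd1 : forall x, u <= x <= w -> is_derive h x (h' x)) by (intros; apply Hd; lra).
    (* The cut point [w] is attributed to the left piece only. Unless it is a zero of [h], it stops
       being a cut, and what lies between the last zero and [w] joins the first piece of the tail;
       hence each old piece adds at most one. *)
    destruct (classic (exists z, u < z <= w /\ h z = 0)) as [[z [Hz Ez]]|H].
    + exists (S r'). split; [lia|]. apply nonzero_pieces_cons with z; [lra| |].
      * intros x Hx Ex. exact (inj u w Huw Hd1 Hn x z ltac:(lra) ltac:(lra) ltac:(lra) Ex Ez).
      * destruct (Req_dec z w) as [->|Hzw]; [exact Hp'|].
        apply nonzero_pieces_extend with w; [lra| |exact Hp']. intros x Hx.
        exact (inj u w Huw Hd1 Hn z x ltac:(lra) ltac:(lra) ltac:(lra) Ez).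
    + exists r'. split; [lia|]. apply nonzero_pieces_extend with w; [lra| |exact Hp'].
      intros x Hx Ex. apply H. exists x. split; assumption.
Qed.

Lemma nonzero_pieces_chain (k : nat) : forall (F : nat -> R -> R) (a b u v : R),
  chain F k a b -> (forall x, a < x < b -> F k x <> 0) -> a < u -> u < v -> v < b ->
  exists r, (r <= S k)%nat /\ nonzero_pieces (F O) r u v.
Proof.
  induction k as [|k IH]; intros F a b u v HF Hn Hu Huv Hv.
  - exists 1%nat. split; [lia|]. constructor; [lra|]. intros; apply Hn; lra.
  - destruct (IH (fun j => F (S j)) a b u v) as [r [Hr Hp]]; auto.
    + intros j x Hj Hx. apply HF; [lia|exact Hx].
    + destruct (nonzero_pieces_antiderivative (F O) (F 1%nat) r u v) as [r' [Hr' Hp']]; auto.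
      * intros x Hx. apply HF; [lia|lra].
      * exists r'. split; [lia|exact Hp'].
Qed.

(* [E] restricted to [[u, v]] has (inner) measure at least [L], witnessed by an
   expanding map from [[0, L]] into it. *)
Definition thick (E : R -> Prop) (u v L : R) : Prop :=
  0 <= L /\ (0 < L -> exists tau : R -> R,
    (forall s, 0 <= s <= L -> E (tau s) /\ u + s <= tau s <= v - (L - s)) /\
    (forall s t, 0 <= s -> s <= t -> t <= L -> t - s <= tau t - tau s)).

(** The two-sided bounds on [tau] in [thick] serve here: across [w] they give
    [tau1 s <= w - (L1 - s)] and [w + (t - L1) <= tau2 (t - L1)], so the glued map still expands. A
    part of length 0 may contain no point of [E], so then the other map is used alone. *)
Lemma thick_app (E : R -> Prop) (u w v L1 L2 : R) : u <= w -> w <= v ->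
  thick E u w L1 -> thick E w v L2 -> thick E u v (L1 + L2).
Proof.
  intros Huw Hwv [P1 H1] [P2 H2]. split; [lra|]. intros HL.
  destruct (Req_dec L1 0) as [->|E1].
  { destruct H2 as [tau [Ht Hx]]; [lra|]. exists tau. split.
    - intros s Hs. destruct (Ht s); [lra|]. split; [assumption|lra].
    - intros s t Hs Hst Htl. apply Hx; lra. }
  destruct (Req_dec L2 0) as [->|E2].
  { destruct H1 as [tau [Ht Hx]]; [lra|]. exists tau. split.
    - intros s Hs. destruct (Ht s); [lra|]. split; [assumption|lra].
    - intros s t Hs Hst Htl. apply Hx; lra. }
  destruct H1 as [tau1 [Ht1 Hx1]]; [lra|]. destruct H2 as [tau2 [Ht2 Hx2]]; [lra|].
  exists (fun s => if Rle_dec s L1 then tau1 s else tau2 (s - L1)). split.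
  - intros s Hs. destruct (Rle_dec s L1) as [C|C].
    + destruct (Ht1 s); [lra|]. destruct (Ht2 0); [lra|]. split; [assumption|lra].
    + destruct (Ht2 (s - L1)); [lra|]. destruct (Ht1 0); [lra|]. split; [assumption|lra].
  - intros s t Hs Hst Htl. destruct (Rle_dec s L1) as [C|C], (Rle_dec t L1) as [D|D].
    + apply Hx1; lra.
    + destruct (Ht1 s); [lra|]. destruct (Ht2 (t - L1)); lra.
    + lra.
    + specialize (Hx2 (s - L1) (t - L1)). lra.
Qed.

(** * The first derivative test *)

Definition derivatives_on (f g h : R -> R) (a b : R) : Prop :=
  forall x, a < x < b -> is_derive f x (g x) /\ is_derive g x (h x).

(* For [p^2 + q^2 = 1], the component of [e^{if}] in the direction [p + iq]. *)
Definition osc_component (p q : R) (f : R -> R) (x : R) : R :=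
  p * cos (f x) + q * sin (f x).

Lemma unit_combination_bound (p q t : R) : p ^ 2 + q ^ 2 = 1 ->
  -1 <= p * cos t + q * sin t <= 1.
Proof.
  intros Hpq. pose proof (sin2_cos2 t) as H. unfold Rsqr in H.
  pose proof (Rle_0_sqr (p - cos t)) as H1. pose proof (Rle_0_sqr (q - sin t)) as H2.
  pose proof (Rle_0_sqr (p + cos t)) as H3. pose proof (Rle_0_sqr (q + sin t)) as H4.
  unfold Rsqr in *. split; lra.
Qed.

Lemma osc_component_continuous (p q : R) (f : R -> R) (x : R) :
  ex_derive f x -> continuous (osc_component p q f) x.
Proof.
  intros Hf. apply (ex_derive_continuous (osc_component p q f)). unfold osc_component.
  auto_derive. auto.
Qed.

Lemma osc_component_ex_RInt (p q : R) (f g h : R -> R) (a b u v : R) :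
  derivatives_on f g h a b -> a < u -> u <= v -> v < b ->
  ex_RInt (osc_component p q f) u v.
Proof.
  intros Hd Hu Huv Hv. apply (@ex_RInt_continuous R_CompleteNormedModule).
  rewrite Rmin_left, Rmax_right by lra. intros x Hx.
  apply osc_component_continuous. exists (g x). apply Hd. lra.
Qed.

Lemma osc_component_RInt_le (p q : R) (f : R -> R) (u v : R) : p ^ 2 + q ^ 2 = 1 ->
  u <= v -> ex_RInt (osc_component p q f) u v -> RInt (osc_component p q f) u v <= v - u.
Proof.
  intros Hpq Huv Hi.
  replace (v - u) with (RInt (fun _ => 1) u v).
  - apply RInt_le; auto using ex_RInt_const.
    intros x _. apply unit_combination_bound, Hpq.
  - rewrite RInt_const. unfold scal; simpl; unfold mult; simpl. ring.
Qed.

(* With [S = p sin f - q cos f], so that [S' = g (p cos f + q sin f)], the function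
   [x |-> RInt (p cos f + q sin f) u x - (S x - 1) / g x] has derivative
   [(S - 1) h / g^2 <= 0]. Unlike integration by parts, this does not require
   [h] to be integrable. *)
Lemma first_derivative_test (f g h : R -> R) (a b p q al u v : R) :
  derivatives_on f g h a b -> a < u -> u < v -> v < b -> p ^ 2 + q ^ 2 = 1 -> 0 < al ->
  (forall x, u <= x <= v -> al <= g x) \/ (forall x, u <= x <= v -> g x <= - al) ->
  (forall x, u < x < v -> 0 <= h x) ->
  RInt (osc_component p q f) u v <= 2 / al.
Proof.
  intros Hd Hu Huv Hv Hpq Hal Hg Hh.
  assert (Hg0 : forall x, u <= x <= v -> g x <> 0).
  { intros x Hx. destruct Hg as [Hg|Hg]; specialize (Hg x Hx); lra. }
  set (S := fun x => p * sin (f x) - q * cos (f x)).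
  assert (HS : forall x, -1 <= S x <= 1).
  { intros x. pose proof (unit_combination_bound (- q) p (f x)) as H.
    unfold S. rewrite <- Rsqr_pow2, <- Rsqr_neg, !Rsqr_pow2 in H. lra. }
  destruct (mvt (fun x => RInt (osc_component p q f) u x - (S x - 1) / g x)
                (fun x => (S x - 1) * h x / g x ^ 2) u v Huv) as [c [Hc E]].
  { intros x Hx. destruct (Hd x ltac:(lra)) as [Hf Hgx].
    assert (HdS : is_derive (fun x => S x - 1) x (g x * osc_component p q f x)).
    { unfold S. auto_derive; [split; [exists (g x); exact Hf|split; [exists (g x); exact Hf|trivial]]|].
      replace (Derive _ x) with (g x) by (symmetry; apply is_derive_unique; exact Hf). unfold osc_component. ring. }
    assert (HdI : is_derive (fun x => RInt (osc_component p q f) u x) x (osc_component p q f x)).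
    { apply is_derive_RInt with u.
      - assert (Hxa : 0 < Rmin (x - a) (b - x)) by (apply Rmin_pos; lra).
        exists (mkposreal _ Hxa). intros y Hy.
        unfold ball in Hy; simpl in Hy; unfold AbsRing_ball, abs, minus, plus, opp in Hy; simpl in Hy.
        pose proof (Rmin_l (x - a) (b - x)). pose proof (Rmin_r (x - a) (b - x)).
        apply Rabs_def2 in Hy.
        apply (@RInt_correct R_CompleteNormedModule).
        apply (@ex_RInt_continuous R_CompleteNormedModule). intros z Hz.
        apply osc_component_continuous. exists (g z). apply Hd. split.
        + apply Rlt_le_trans with (2 := proj1 Hz). apply Rmin_glb_lt; lra.
        + apply Rle_lt_trans with (1 := proj2 Hz). apply Rmax_lub_lt; lra.
      - apply osc_component_continuous. exists (g x). exact Hf. }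
    pose proof (is_derive_minus _ _ _ _ _ HdI (is_derive_div _ _ _ _ _ HdS Hgx (Hg0 x Hx))) as H.
    replace ((S x - 1) * h x / g x ^ 2) with
      (minus (osc_component p q f x)
         ((g x * osc_component p q f x * g x - (S x - 1) * h x) / g x ^ 2)).
    - exact H.
    - unfold minus, plus, opp; simpl. field. now apply Hg0. }
  assert (Hdec : (S c - 1) * h c / g c ^ 2 * (v - u) <= 0).
  { specialize (Hh c Hc). specialize (HS c). specialize (Hg0 c ltac:(lra)).
    assert (0 < / g c ^ 2 * (v - u)).
    { apply Rmult_lt_0_compat; [|lra]. apply Rinv_0_lt_compat.
      rewrite <- Rsqr_pow2. now apply Rlt_0_sqr. }
    assert ((S c - 1) * h c <= 0) by nra.
    unfold Rdiv. rewrite Rmult_assoc. nra. }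
  rewrite (RInt_point (V := R_CompleteNormedModule) u) in E. change zero with 0 in E.
  (* [S - 1] lies in [[-2, 0]] and [g] keeps its sign, so only one of the two end terms is
     nonnegative; this gives [2 / al] instead of [4 / al]. *)
  assert (Hend : (S v - 1) / g v - (S u - 1) / g u <= 2 / al).
  { pose proof (HS u) as Bu. pose proof (HS v) as Bv.
    assert (Hinv : forall y, al <= y -> 0 < / y <= / al).
    { intros y Hy. split; [apply Rinv_0_lt_compat; lra|]. apply Rinv_le_contravar; lra. }
    unfold Rdiv. destruct Hg as [Hg|Hg].
    - pose proof (Hinv (g u) (Hg u ltac:(lra))). pose proof (Hinv (g v) (Hg v ltac:(lra))). nra.
    - pose proof (Hg u ltac:(lra)). pose proof (Hg v ltac:(lra)).
      pose proof (Hinv (- g u) ltac:(lra)) as H1. pose proof (Hinv (- g v) ltac:(lra)) as H2.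
      rewrite Rinv_opp in H1, H2. nra. }
  lra.
Qed.

(** For increasing [g] the point [z] separates low values from high ones; the equalities with [u]
    and [v] cover a level that is not attained. *)
Lemma threshold_exists (g : R -> R) (u v c : R) : u <= v ->
  (forall x, u <= x <= v -> continuity_pt g x) ->
  exists z, u <= z <= v /\ (u = z \/ g z <= c) /\ (z = v \/ c <= g z).
Proof.
  intros Huv Hc.
  destruct (Rle_lt_dec c (g u)) as [Hu|Hu].
  { exists u. repeat split; auto; lra. }
  destruct (Rle_lt_dec (g v) c) as [Hv|Hv].
  { exists v. repeat split; auto; lra. }
  destruct (IVT_interv (fun x => g x - c) u v) as [z [Hz E]]; try lra.
  - intros x Hx. apply continuity_pt_minus; [now apply Hc|].
    apply continuity_pt_const. intros y y'. reflexivity.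
  - destruct Huv as [Huv|Huv]; [exact Huv|]. subst v. lra.
  - exists z. repeat split; try lra; right; lra.
Qed.

(** Cutting at the levels [-al] and [al] leaves two outer intervals for the first derivative test,
    at [2 / al] each, and a middle one inside the sublevel set, where the integrand is at most 1 and
    a translation serves as [tau]. *)
Lemma monotone_piece_up (f g h : R -> R) (a b p q al u v : R) :
  derivatives_on f g h a b -> a < u -> u < v -> v < b -> p ^ 2 + q ^ 2 = 1 -> 0 < al ->
  (forall x, u < x < v -> 0 <= h x) ->
  exists L, thick (fun x => Rabs (g x) <= al) u v L /\
    RInt (osc_component p q f) u v <= L + 4 / al.
Proof.
  intros Hd Hu Huv Hv Hpq Hal Hh.
  assert (Hmon : forall x y, u <= x -> x <= y -> y <= v -> g x <= g y).
  { intros x y Hx [Hxy| ->] Hy; [|lra].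
    destruct (mvt g h x y Hxy) as [c [Hc E]].
    - intros t Ht. apply Hd. lra.
    - specialize (Hh c ltac:(lra)). nra. }
  assert (Hcont : forall x, u <= x <= v -> continuity_pt g x).
  { intros x Hx. apply derivable_continuous_pt. exists (h x).
    apply is_derive_Reals, Hd. lra. }
  destruct (threshold_exists g u v (- al)) as [z1 [Hz1 [A1 B1]]]; [lra|exact Hcont|].
  destruct (threshold_exists g z1 v al) as [z2 [Hz2 [A2 B2]]];
    [lra|intros; apply Hcont; lra|].
  assert (Hint : forall x y, u <= x -> x <= y -> y <= v -> ex_RInt (osc_component p q f) x y).
  { intros x y Hx Hxy Hy. apply (osc_component_ex_RInt p q f g h a b); auto; lra. }
  exists (z2 - z1). split.
  - split; [lra|]. intros HL. exists (fun s => z1 + s). split; [|intros; lra].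
    intros s Hs. split; [|lra]. apply Rabs_le. split.
    + apply Rle_trans with (g z1); [lra|]. apply Hmon; lra.
    + apply Rle_trans with (g z2); [|lra]. apply Hmon; lra.
  - rewrite <- (RInt_Chasles (V := R_CompleteNormedModule) _ u z1 v) by (apply Hint; lra).
    rewrite <- (RInt_Chasles (V := R_CompleteNormedModule) _ z1 z2 v) by (apply Hint; lra).
    unfold plus; simpl.
    assert (H2 : RInt (osc_component p q f) z1 z2 <= z2 - z1).
    { apply osc_component_RInt_le; auto; [lra|apply Hint; lra]. }
    assert (Hal2 : 0 < 2 / al) by (apply Rdiv_lt_0_compat; lra).
    assert (H1 : RInt (osc_component p q f) u z1 <= 2 / al).
    { destruct (Req_dec u z1) as [<-|Hne].
      - rewrite RInt_point. unfold zero; simpl. lra.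
      - apply (first_derivative_test f g h a b); auto; try lra.
        + right. intros x Hx. apply Rle_trans with (g z1); [|lra]. apply Hmon; lra.
        + intros x Hx. apply Hh. lra. }
    assert (H3 : RInt (osc_component p q f) z2 v <= 2 / al).
    { destruct (Req_dec z2 v) as [->|Hne].
      - rewrite RInt_point. unfold zero; simpl. lra.
      - apply (first_derivative_test f g h a b); auto; try lra.
        + left. intros x Hx. apply Rle_trans with (g z2); [lra|]. apply Hmon; lra.
        + intros x Hx. apply Hh. lra. }
    lra.
Qed.

Lemma thick_ext (E E' : R -> Prop) (u v L : R) :
  (forall x, E x -> E' x) -> thick E u v L -> thick E' u v L.
Proof.
  intros HE [H0 H]. split; [exact H0|]. intros HL.
  destruct (H HL) as [tau [H1 H2]]. exists tau. split; [|exact H2].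
  intros s Hs. destruct (H1 s Hs). auto.
Qed.

Lemma monotone_piece (f g h : R -> R) (a b p q al u v : R) :
  derivatives_on f g h a b -> a < u -> u < v -> v < b -> p ^ 2 + q ^ 2 = 1 -> 0 < al ->
  (forall x, u < x < v -> h x <> 0) ->
  exists L, thick (fun x => Rabs (g x) <= al) u v L /\
    RInt (osc_component p q f) u v <= L + 4 / al.
Proof.
  intros Hd Hu Huv Hv Hpq Hal Hh.
  destruct (derivative_sign g h u v) as [Hs|Hs]; [intros; apply Hd; lra|exact Hh| |].
  - now apply (monotone_piece_up f g h a b).
  (* Replacing [f] by [-f] and [q] by [-q] leaves the component unchanged and reverses the sign of
     [h]. *)
  - destruct (monotone_piece_up (fun x => - f x) (fun x => - g x) (fun x => - h x) a b p (- q) al u v)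
      as [L [H1 H2]]; auto.
    + intros x Hx. destruct (Hd x Hx). split; [now apply (is_derive_opp f)|now apply (is_derive_opp g)].
    + rewrite <- Hpq. ring.
    + intros x Hx. specialize (Hs x Hx). lra.
    + exists L. split.
      * revert H1. apply thick_ext. intros x. now rewrite Rabs_Ropp.
      * rewrite (RInt_ext _ (osc_component p (- q) (fun x => - f x))); [exact H2|].
        intros x _. unfold osc_component. now rewrite cos_neg, sin_neg, Rmult_opp_opp.
Qed.

(** The thick parts are glued into one set, so that the sublevel estimate is paid once and not once
    per piece. *)
Lemma pieces_bound (f g h : R -> R) (a b p q al : R) (r : nat) (u v : R) :
  derivatives_on f g h a b -> p ^ 2 + q ^ 2 = 1 -> 0 < al ->
  nonzero_pieces h r u v -> a < u -> v < b ->
  exists L, thick (fun x => Rabs (g x) <= al) u v L /\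
    RInt (osc_component p q f) u v <= L + INR r * (4 / al).
Proof.
  intros Hd Hpq Hal Hp.
  induction Hp as [u v Huv Hn|r u w v Huw Hn Hp IH]; intros Hu Hv.
  - simpl INR. rewrite Rmult_1_l. now apply (monotone_piece f g h a b).
  - pose proof (nonzero_pieces_lt _ _ _ _ Hp) as Hwv.
    destruct IH as [L2 [T2 I2]]; [lra|exact Hv|].
    destruct (monotone_piece f g h a b p q al u w) as [L1 [T1 I1]]; auto; [lra|].
    exists (L1 + L2). split; [apply thick_app with w; auto; lra|].
    rewrite <- (RInt_Chasles (V := R_CompleteNormedModule) _ u w v)
      by (apply (osc_component_ex_RInt p q f g h a b); auto; lra).
    rewrite S_INR. unfold plus; simpl. lra.
Qed.

(** [F 2] has at most [S k] pieces because its [k]-th derivative never vanishes; the sublevel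
    estimate concerns [F 1], whose derivative of order [S k] is the one bounded below. *)
Lemma osc_component_interior_bound (k : nat) (F : nat -> R -> R) (a b p q al lambda u v : R) :
  chain F (S (S k)) a b -> (forall x, a < x < b -> lambda <= Rabs (F (S (S k)) x)) ->
  0 < lambda -> p ^ 2 + q ^ 2 = 1 -> 0 < al -> a < u -> u < v -> v < b ->
  exists L, 0 <= L /\
    lambda * L ^ S k <= al * INR (fact (S k)) * 2 ^ (2 * k + 1) /\
    RInt (osc_component p q (F O)) u v <= L + INR (S k) * (4 / al).
Proof.
  intros HF Hlam Hl Hpq Hal Hu Huv Hv.
  assert (Hd : derivatives_on (F 0%nat) (F 1%nat) (F 2%nat) a b).
  { intros x Hx. split; apply HF; auto; lia. }
  destruct (nonzero_pieces_chain k (fun j => F (S (S j))) a b u v) as [r [Hr Hp]]; auto.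
  { intros j x Hj Hx. apply HF; [lia|exact Hx]. }
  { intros x Hx E. specialize (Hlam x Hx). rewrite E, Rabs_R0 in Hlam. lra. }
  destruct (pieces_bound _ _ _ a b p q al r u v Hd Hpq Hal Hp Hu Hv) as [L [[HL HT] HI]].
  exists L. split; [exact HL|]. split.
  - destruct HL as [HL|<-].
    + destruct (HT HL) as [tau [Ht Hx]].
      apply (sublevel_estimate k (fun j => F (S j)) tau a b); auto.
      * intros j x Hj Hx'. apply HF; [lia|exact Hx'].
      * intros s Hs. destruct (Ht s Hs). split; [lra|assumption].
    (* Here [L = 0], so [thick] provides no [tau]; the left side is 0 since the exponent is
       positive. *)
    + rewrite pow_i by lia. rewrite Rmult_0_r.
      pose proof (INR_fact_lt_0 (S k)). assert (0 < 2 ^ (2 * k + 1)) by (apply pow_lt; lra).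
      apply Rmult_le_pos; [apply Rmult_le_pos; lra|lra].
  - apply Rle_trans with (1 := HI). apply Rplus_le_compat_l. apply Rmult_le_compat_r.
    + left. apply Rdiv_lt_0_compat; lra.
    + now apply le_INR.
Qed.

(** * Integrability on an open interval *)

Lemma step_constant_open (f : R -> R) (a b c : R) :
  a <= b -> (forall x, a < x < b -> f x = c) ->
  { pre : IsStepFun f a b | RiemannInt_SF (mkStepFun pre) = c * (b - a) }.
Proof.
  intros Hab Hf.
  assert (pre : IsStepFun f a b).
  { exists (a :: b :: nil)%list, (c :: nil)%list. repeat split.
    - intros [|i] Hi; simpl in *; [exact Hab|lia].
    - simpl. now rewrite Rmin_left.
    - simpl. now rewrite Rmax_right.
    - intros [|i] Hi; simpl in *; [|lia].
      intros x Hx. apply Hf, Hx. }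
  exists pre. rewrite <- (StepFun_P18 a b c).
  apply Rle_antisym; apply StepFun_P37; trivial;
    intros x Hx; simpl; unfold fct_cte; rewrite Hf; auto; lra.
Qed.

(** The integrand may oscillate without limit at [a]. It is replaced by 0 on [[a, c)], with error at
    most [M] there, and [c] is so close to [a] that this costs less than [eps / 2]. *)
Lemma ex_RInt_bounded_left (f : R -> R) (a b M : R) :
  a < b -> (forall x, Rabs (f x) <= M) ->
  (forall c, a < c < b -> ex_RInt f c b) -> ex_RInt f a b.
Proof.
  intros Hab HM Hf.
  assert (M0 : 0 <= M) by (apply Rle_trans with (2 := HM a), Rabs_pos).
  apply ex_RInt_Reals_1. intros eps.
  set (c := a + Rmin ((b - a) / 2) (eps / 2 / (M + 1))).
  assert (He : 0 < eps / 2 / (M + 1)).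
  { pose proof (cond_pos eps). apply Rdiv_lt_0_compat; lra. }
  assert (Hc : a < c < b).
  { unfold c. pose proof (Rmin_l ((b - a) / 2) (eps / 2 / (M + 1))).
    assert (0 < Rmin ((b - a) / 2) (eps / 2 / (M + 1))) by (apply Rmin_pos; lra). lra. }
  assert (HcM : M * (c - a) < eps / 2).
  { pose proof (Rmin_r ((b - a) / 2) (eps / 2 / (M + 1))).
    apply Rlt_le_trans with ((M + 1) * (c - a)).
    - apply Rmult_lt_compat_r; lra.
    - apply Rle_trans with ((M + 1) * (eps / 2 / (M + 1))).
      + apply Rmult_le_compat_l; unfold c; lra.
      + right. field. lra. }
  set (phi := fun x => if Rlt_dec x c then 0 else f x).
  set (psi := fun x => if Rlt_dec x c then M else 0).
  assert (Hphi : ex_RInt phi a b).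
  { apply ex_RInt_Chasles with c.
    - apply ex_RInt_ext with (fun _ => 0); [|apply ex_RInt_const].
      rewrite Rmin_left, Rmax_right by lra. intros x Hx. unfold phi.
      destruct (Rlt_dec x c); lra.
    - apply ex_RInt_ext with f; [|now apply Hf].
      rewrite Rmin_left, Rmax_right by lra. intros x Hx. unfold phi.
      destruct (Rlt_dec x c); lra. }
  assert (eps2 : 0 < eps / 2) by (pose proof (cond_pos eps); lra).
  destruct (ex_RInt_Reals_0 phi a b Hphi (mkposreal _ eps2)) as [phi' [psi' [H1 H2]]].
  destruct (step_constant_open psi a c M) as [pre1 I1]; [lra| |].
  { intros x Hx. unfold psi. destruct (Rlt_dec x c); lra. }
  destruct (step_constant_open psi c b 0) as [pre2 I2]; [lra| |].
  { intros x Hx. unfold psi. destruct (Rlt_dec x c); lra. }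
  assert (pre3 : IsStepFun psi a b) by (apply StepFun_P41 with c; auto; lra).
  pose proof (StepFun_P43 pre1 pre2 pre3) as I3.
  exists phi', (mkStepFun (StepFun_P28 1 (mkStepFun pre3) psi')).
  split.
  - intros t Ht. simpl. unfold psi.
    specialize (H1 t Ht). unfold phi in H1. simpl in H1.
    destruct (Rlt_dec t c).
    + specialize (HM t). unfold Rabs in *.
      repeat destruct Rcase_abs in *; repeat destruct Rcase_abs; lra.
    + lra.
  - rewrite StepFun_P30. simpl in H2. rewrite <- I3, I1, I2.
    rewrite Rmult_1_l.
    apply Rle_lt_trans with (1 := Rabs_triang _ _).
    rewrite (Rabs_pos_eq (_ + _)); [lra|].
    assert (0 <= M * (c - a)) by (apply Rmult_le_pos; lra). lra.
Qed.

Lemma ex_RInt_bounded_open (f : R -> R) (a b M : R) :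
  a < b -> (forall x, Rabs (f x) <= M) ->
  (forall x, a < x < b -> continuous f x) -> ex_RInt f a b.
Proof.
  intros Hab HM Hc.
  set (m := (a + b) / 2).
  apply ex_RInt_Chasles with m.
  - apply ex_RInt_bounded_left with M; [unfold m; lra|exact HM|].
    intros c Hcm. apply (@ex_RInt_continuous R_CompleteNormedModule). unfold m in *.
    intros z. rewrite Rmin_left, Rmax_right by lra. intros Hz. apply Hc; lra.
  - apply ex_RInt_swap.
    (* The reflection [x -> -x] makes the right endpoint a left one; the double signs match
       [ex_RInt_comp_opp]. *)
    apply ex_RInt_ext with (fun y => opp (- f (- - y))).
    { intros. unfold opp; simpl. rewrite Ropp_involutive. now rewrite Ropp_involutive. }
    apply (ex_RInt_comp_opp (fun y => - f (- y))).
    apply ex_RInt_bounded_left with M; [unfold m; lra| |].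
    + intros x. rewrite Rabs_Ropp. apply HM.
    + intros c Hcm. apply (@ex_RInt_continuous R_CompleteNormedModule). unfold m in *.
      intros z. rewrite Rmin_left, Rmax_right by lra. intros Hz.
      apply (continuous_opp (fun y => f (- y))).
      apply (continuous_comp Ropp f); [|apply Hc; lra].
      apply (ex_derive_continuous (fun y : R => - y)). auto_derive. trivial.
Qed.

(** * The van der Corput estimate *)

(** Exhaustion by [[a + d, b - d]]: the end strips cost at most [2 d <= eps]. The length [L] varies
    with [d], hence a bound [B] valid for every admissible [L]. *)
Lemma osc_component_bound (k : nat) (F : nat -> R -> R) (a b p q al lambda B : R) :
  a < b -> chain F (S (S k)) a b ->
  (forall x, a < x < b -> lambda <= Rabs (F (S (S k)) x)) ->
  0 < lambda -> p ^ 2 + q ^ 2 = 1 -> 0 < al ->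
  (forall L, 0 <= L -> lambda * L ^ S k <= al * INR (fact (S k)) * 2 ^ (2 * k + 1) ->
     L + INR (S k) * (4 / al) <= B) ->
  ex_RInt (osc_component p q (F O)) a b /\ RInt (osc_component p q (F O)) a b <= B.
Proof.
  intros Hab HF Hlam Hl Hpq Hal HB.
  assert (Hex : forall x y, a <= x -> x < y -> y <= b -> ex_RInt (osc_component p q (F O)) x y).
  { intros x y Hx Hxy Hy. apply ex_RInt_bounded_open with 1; [exact Hxy| |].
    - intros t. apply Rabs_le, unit_combination_bound, Hpq.
    - intros t Ht. apply osc_component_continuous. exists (F 1%nat t). apply HF; [lia|lra]. }
  split; [apply Hex; lra|].
  apply le_epsilon. intros eps Heps.
  set (d := Rmin (eps / 2) ((b - a) / 3)).
  pose proof (Rmin_l (eps / 2) ((b - a) / 3)). pose proof (Rmin_r (eps / 2) ((b - a) / 3)).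
  assert (0 < d) by (apply Rmin_pos; lra). fold d in H, H0.
  rewrite <- (RInt_Chasles (V := R_CompleteNormedModule) _ a (a + d) b) by (apply Hex; lra).
  rewrite <- (RInt_Chasles (V := R_CompleteNormedModule) _ (a + d) (b - d) b)
    by (apply Hex; lra).
  unfold plus; simpl.
  assert (I1 : RInt (osc_component p q (F O)) a (a + d) <= a + d - a).
  { apply osc_component_RInt_le; [exact Hpq|lra|apply Hex; lra]. }
  assert (I3 : RInt (osc_component p q (F O)) (b - d) b <= b - (b - d)).
  { apply osc_component_RInt_le; [exact Hpq|lra|apply Hex; lra]. }
  destruct (osc_component_interior_bound k F a b p q al lambda (a + d) (b - d))
    as [L [HL [H2 H3]]]; auto; try lra.
  specialize (HB L HL H2). lra.
Qed.

(** * From real components to the complex integral *)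

Lemma osc_pair (f : R -> R) (t : R) : osc f t = (cos (f t), sin (f t)).
Proof.
  unfold osc, Cexp. simpl.
  replace (0 * f t - 1 * 0) with 0 by ring. replace (0 * 0 + 1 * f t) with (f t) by ring.
  now rewrite exp_0, !Rmult_1_l.
Qed.

Lemma Cmod_le_components (z : C) (B : R) :
  0 <= B -> (forall p q, p ^ 2 + q ^ 2 = 1 -> p * fst z + q * snd z <= B) -> Cmod z <= B.
Proof.
  intros HB Hz. destruct (Req_dec (Cmod z) 0) as [E|E]; [lra|].
  assert (Hs : Cmod z * Cmod z = fst z ^ 2 + snd z ^ 2).
  { apply sqrt_sqrt. nra. }
  (* In the direction of [z] itself the component equals the modulus. *)
  specialize (Hz (fst z / Cmod z) (snd z / Cmod z)).
  replace (fst z / Cmod z * fst z + snd z / Cmod z * snd z) with (Cmod z) in Hz.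
  - apply Hz. apply Rmult_eq_reg_r with (Cmod z * Cmod z).
    + rewrite Hs at 2. field. exact E.
    + now apply Rmult_integral_contrapositive_currified.
  - apply Rmult_eq_reg_r with (Cmod z); [|exact E]. rewrite Hs. field. exact E.
Qed.

Lemma osc_RInt_bound (f : R -> R) (a b B : R) : 0 <= B ->
  (forall p q, p ^ 2 + q ^ 2 = 1 ->
     ex_RInt (osc_component p q f) a b /\ RInt (osc_component p q f) a b <= B) ->
  ex_RInt (osc f) a b /\ Cmod (RInt (osc f) a b) <= B.
Proof.
  intros HB H.
  assert (Hc : is_RInt (fun t => cos (f t)) a b (RInt (fun t => cos (f t)) a b)).
  { apply (RInt_correct (V := R_CompleteNormedModule)).
    apply ex_RInt_ext with (osc_component 1 0 f); [|apply H; ring].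
    intros x _. unfold osc_component. now rewrite Rmult_0_l, Rplus_0_r, Rmult_1_l. }
  assert (Hs : is_RInt (fun t => sin (f t)) a b (RInt (fun t => sin (f t)) a b)).
  { apply (RInt_correct (V := R_CompleteNormedModule)).
    apply ex_RInt_ext with (osc_component 0 1 f); [|apply H; ring].
    intros x _. unfold osc_component. now rewrite Rmult_0_l, Rplus_0_l, Rmult_1_l. }
  set (I1 := RInt (fun t => cos (f t)) a b) in Hc. set (I2 := RInt (fun t => sin (f t)) a b) in Hs.
  assert (Ho : is_RInt (osc f) a b (I1, I2)).
  { apply (is_RInt_fct_extend_pair (U := R_NormedModule) (V := R_NormedModule)).
    - apply is_RInt_ext with (2 := Hc). intros x _. now rewrite osc_pair.
    - apply is_RInt_ext with (2 := Hs). intros x _. now rewrite osc_pair. }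
  split; [exists (I1, I2); exact Ho|].
  rewrite (is_RInt_unique _ _ _ _ Ho). apply Cmod_le_components; [exact HB|].
  intros p q Hpq. apply Rle_trans with (2 := proj2 (H p q Hpq)). right. simpl.
  symmetry. apply is_RInt_unique.
  apply (is_RInt_plus (V := R_NormedModule) (fun t => p * cos (f t)) (fun t => q * sin (f t)));
    now apply (is_RInt_scal (V := R_NormedModule)).
Qed.

(** * The constants: optimization, uniform bound and limit *)

Definition vdc_base (n : nat) : R :=
  2 ^ (2 * n - 1) * INR (fact (n - 1)) / INR (n - 1) ^ (n - 2).

Definition vdc_constant (n : nat) : R := Rpower (vdc_base n) (1 / INR n).

Lemma vdc_base_SS (k : nat) :
  vdc_base (S (S k)) = 2 ^ (2 * k + 3) * INR (fact (S k)) / INR (S k) ^ k.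
Proof.
  unfold vdc_base. replace (2 * S (S k) - 1)%nat with (2 * k + 3)%nat by lia.
  replace (S (S k) - 1)%nat with (S k) by lia. now replace (S (S k) - 2)%nat with k by lia.
Qed.

Lemma vdc_base_pos (k : nat) : 0 < vdc_base (S (S k)).
Proof.
  rewrite vdc_base_SS. apply Rdiv_lt_0_compat.
  - apply Rmult_lt_0_compat; [apply pow_lt; lra|apply INR_fact_lt_0].
  - apply pow_lt, lt_0_INR. lia.
Qed.

Lemma Rpower_inv_pow (x : R) (n : nat) : 0 < x -> (0 < n)%nat -> Rpower x (1 / INR n) ^ n = x.
Proof.
  intros Hx Hn. rewrite <- Rpower_pow by apply exp_pos. rewrite Rpower_mult.
  replace (1 / INR n * INR n) with 1 by (field; apply not_0_INR; lia).
  now apply Rpower_1.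
Qed.

Lemma pow_lt_compat (x y : R) (k : nat) : 0 <= x -> x < y -> x ^ S k < y ^ S k.
Proof.
  intros Hx Hxy. induction k as [|k IH].
  - rewrite !pow_1. exact Hxy.
  - change (x * x ^ S k < y * y ^ S k). apply Rmult_le_0_lt_compat; auto.
    now apply pow_le.
Qed.

(* [al = 4 (n - 1) n / B] minimizes the sum of the sublevel bound and the
   contribution of the monotone pieces; the minimum is [B]. *)
Lemma optimal_threshold (k : nat) (lambda B L : R) : 0 < lambda -> 0 < B -> 0 <= L ->
  lambda * B ^ S (S k) = vdc_base (S (S k)) * INR (S (S k)) ^ S (S k) ->
  let al := 4 * INR (S k) * INR (S (S k)) / B in
  lambda * L ^ S k <= al * INR (fact (S k)) * 2 ^ (2 * k + 1) ->
  L + INR (S k) * (4 / al) <= B.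
Proof.
  intros Hl HB HL HBn al Hsub.
  rewrite vdc_base_SS in HBn.
  assert (Hm : 0 < INR (S k)) by (apply lt_0_INR; lia).
  assert (Hn : 0 < INR (S (S k))) by (apply lt_0_INR; lia).
  assert (Hmk : 0 < INR (S k) ^ k) by (now apply pow_lt).
  assert (Hnk : 0 < INR (S (S k)) ^ S k) by (now apply pow_lt).
  assert (Hmn : INR (S (S k)) = INR (S k) + 1) by apply S_INR.
  (* With [n = S (S k)], the optimum splits [B] into [M = B (n - 1) / n] for the sublevel set and
     [B / n] for the monotone pieces; [M] is the length at which the sublevel bound is an
     equality. *)
  set (M := B * INR (S k) / INR (S (S k))).
  assert (HM : 0 < M) by (apply Rdiv_lt_0_compat; [now apply Rmult_lt_0_compat|exact Hn]).
  replace (INR (S k) * (4 / al)) with (B - M).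
  2:{ unfold M, al. rewrite Hmn. field. repeat split; lra. }
  enough (L <= M) by lra.
  apply Rnot_lt_le. intros HML.
  pose proof (pow_lt_compat M L k (Rlt_le _ _ HM) HML) as Hpow.
  assert (HME : lambda * M ^ S k = al * INR (fact (S k)) * 2 ^ (2 * k + 1)).
  { apply Rmult_eq_reg_r with (B * INR (S (S k)) ^ S k * INR (S k) ^ k).
    2:{ apply Rgt_not_eq. apply Rmult_lt_0_compat; [apply Rmult_lt_0_compat; assumption|assumption]. }
    transitivity (lambda * B ^ S (S k) * INR (S k) ^ S k * INR (S k) ^ k).
    - unfold M, Rdiv. rewrite !Rpow_mult_distr, pow_inv.
      change (B ^ S (S k)) with (B * B ^ S k). field. lra.
    - rewrite HBn. unfold al.
      replace (2 * k + 3)%nat with (2 * k + 1 + 2)%nat by lia. rewrite (pow_add 2 (2 * k + 1) 2).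
      change (INR (S (S k)) ^ S (S k)) with (INR (S (S k)) * INR (S (S k)) ^ S k).
      change (INR (S k) ^ S k) with (INR (S k) * INR (S k) ^ k). field. lra. }
  assert (lambda * M ^ S k < lambda * L ^ S k) by (apply Rmult_lt_compat_l; assumption).
  lra.
Qed.

(** This is the cube of [vdc_base n <= 2 ^ (5 n / 3)] for [n = k + 2], with powers of 2 cancelled.
    The inductive step is Bernoulli's inequality. *)
Lemma vdc_base_le_aux (k : nat) :
  2 ^ k * INR (fact (S k)) ^ 3 <= 2 * INR (S k) ^ (3 * k).
Proof.
  (* The inductive step fails from 0 to 1, so the induction starts at 1, where equality holds. *)
  destruct k as [|k]; [simpl; lra|].
  induction k as [|k IH]; [simpl; lra|].
  set (m := S (S k)) in *.
  assert (Hm : 1 <= INR k + 1) by (pose proof (pos_INR k); lra).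
  assert (Em : INR m = INR k + 2) by (unfold m; rewrite !S_INR; ring).
  assert (Hstep : 2 * INR m ^ (3 * S k) <= INR (S m) ^ (3 * S k)).
  { replace (INR (S m)) with (INR m * (1 + / INR m)) by (rewrite S_INR; field; lra).
    rewrite Rpow_mult_distr, Rmult_comm. apply Rmult_le_compat_l; [apply pow_le; lra|].
    apply Rle_trans with (1 + INR (3 * S k) * / INR m).
    - enough (1 <= INR (3 * S k) * / INR m) by lra.
      apply Rmult_le_reg_r with (INR m); [lra|]. rewrite Rmult_assoc, Rinv_l by lra.
      rewrite mult_INR, (S_INR k), Em. replace (INR 3) with 3 by (simpl; ring). lra.
    - apply poly. apply Rinv_0_lt_compat. lra. }
  replace (3 * m)%nat with (3 * S k + 3)%nat by (unfold m; lia).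
  rewrite (fact_simpl m), mult_INR, Rpow_mult_distr, (pow_add _ (3 * S k) 3).
  change (2 ^ m) with (2 * 2 ^ S k).
  assert (0 < INR (S m) ^ 3) by (apply pow_lt, lt_0_INR; lia).
  replace (2 * 2 ^ S k * (INR (S m) ^ 3 * INR (fact m) ^ 3))
    with (2 * (2 ^ S k * INR (fact m) ^ 3) * INR (S m) ^ 3) by ring.
  replace (2 * (INR (S m) ^ (3 * S k) * INR (S m) ^ 3))
    with (2 * INR (S m) ^ (3 * S k) * INR (S m) ^ 3) by ring.
  apply Rmult_le_compat_r; lra.
Qed.

Lemma vdc_constant_le (k : nat) : vdc_constant (S (S k)) <= Rpower 2 (5 / 3).
Proof.
  set (n := S (S k)). set (X := vdc_base n).
  assert (Hn : 0 < INR n) by (apply lt_0_INR; unfold n; lia).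
  assert (HX : 0 < X) by apply vdc_base_pos.
  assert (HX3 : X ^ 3 <= 2 ^ (5 * n)).
  { unfold X, n. rewrite vdc_base_SS. unfold Rdiv. rewrite !Rpow_mult_distr, pow_inv, <- !pow_mult.
    rewrite (Nat.mul_comm k 3). apply Rmult_le_reg_r with (INR (S k) ^ (3 * k)).
    { apply pow_lt, lt_0_INR; lia. }
    rewrite Rmult_assoc, Rinv_l by (apply pow_nonzero, not_0_INR; lia).
    replace ((2 * k + 3) * 3)%nat with (5 * k + 9 + k)%nat by lia.
    replace (5 * S (S k))%nat with (5 * k + 9 + 1)%nat by lia.
    rewrite (pow_add 2 _ k), (pow_add 2 _ 1), pow_1, Rmult_1_r, !Rmult_assoc.
    apply Rmult_le_compat_l; [apply pow_le; lra|]. apply vdc_base_le_aux. }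
  unfold vdc_constant. fold n X. unfold Rpower.
  assert (Hln : 3 * ln X <= 5 * INR n * ln 2).
  { apply ln_le in HX3; [|now apply pow_lt].
    rewrite !ln_pow in HX3 by lra. rewrite mult_INR in HX3.
    replace (INR 3) with 3 in HX3 by (simpl; ring). replace (INR 5) with 5 in HX3 by (simpl; ring).
    lra. }
  assert (H : 1 / INR n * ln X <= 5 / 3 * ln 2).
  { apply Rmult_le_reg_l with (3 * INR n); [lra|].
    replace (3 * INR n * (1 / INR n * ln X)) with (3 * ln X) by (field; lra). lra. }
  destruct H as [H|H]; [left; now apply exp_increasing|right; now rewrite H].
Qed.

Lemma ln_le_sub_1 (x : R) : 0 < x -> ln x <= x - 1.
Proof.
  intros Hx. rewrite <- (ln_exp (x - 1)). apply ln_le; [exact Hx|].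
  pose proof (exp_ineq1_le (x - 1)). lra.
Qed.

(** Stirling up to a logarithm, enough after division by [n]. The steps [H1] and [H2] say that [e]
    lies between [(1 + 1/m)^m] and [(1 + 1/m)^(m+1)]. *)
Lemma ln_fact_bounds (k : nat) :
  INR (S k) * ln (INR (S k)) - INR (S k) <= ln (INR (fact (S k))) <=
  (INR (S k) + 1) * ln (INR (S k)) - INR (S k) + 1.
Proof.
  induction k as [|k IH].
  - simpl. rewrite ln_1. lra.
  - set (m := S k) in *.
    assert (Hm : 0 < INR m) by (apply lt_0_INR; unfold m; lia).
    assert (HSm : 0 < INR (S m)) by (apply lt_0_INR; lia).
    rewrite (fact_simpl m), mult_INR, ln_mult by (auto using INR_fact_lt_0).
    assert (H1 : INR m * (ln (INR (S m)) - ln (INR m)) <= 1).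
    { rewrite <- ln_div by assumption.
      pose proof (ln_le_sub_1 (INR (S m) / INR m) (Rdiv_lt_0_compat _ _ HSm Hm)) as H.
      apply Rmult_le_compat_l with (r := INR m) in H; [|lra].
      apply Rle_trans with (1 := H). right. rewrite S_INR. field. lra. }
    assert (H2 : 1 <= INR (S m) * (ln (INR (S m)) - ln (INR m))).
    { assert (E : ln (INR m / INR (S m)) = ln (INR m) - ln (INR (S m))) by now apply ln_div.
      pose proof (ln_le_sub_1 (INR m / INR (S m)) (Rdiv_lt_0_compat _ _ Hm HSm)) as H.
      rewrite E in H. apply Rmult_le_compat_l with (r := INR (S m)) in H; [|lra].
      replace (INR (S m) * (INR m / INR (S m) - 1)) with (-1) in H
        by (rewrite S_INR in *; field; lra). lra. }
    rewrite S_INR in *. lra.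
Qed.

Lemma vdc_constant_lim : is_lim_seq vdc_constant (4 / exp 1).
Proof.
  apply (is_lim_seq_incr_n _ 2).
  set (l := fun k => 1 / INR (S (S k)) * ln (vdc_base (S (S k)))).
  apply is_lim_seq_ext with (fun k => exp (l k)).
  { intros k. now replace (k + 2)%nat with (S (S k)) by lia. }
  replace (4 / exp 1) with (exp (2 * ln 2 - 1)).
  2:{ unfold Rminus. rewrite exp_plus, exp_Ropp. replace (2 * ln 2) with (ln 2 + ln 2) by ring.
      rewrite exp_plus, exp_ln by lra. field. apply Rgt_not_eq, exp_pos. }
  apply is_lim_seq_continuous; [apply derivable_continuous_pt, derivable_pt_exp|].
  assert (Hinf : is_lim_seq (fun k => INR (k + 2)) p_infty).
  { apply (is_lim_seq_incr_n INR 2), is_lim_seq_INR. }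
  assert (Hinv : is_lim_seq (fun k => / INR (k + 2)) 0).
  { apply (is_lim_seq_inv _ p_infty); [exact Hinf|discriminate]. }
  assert (Hlog : is_lim_seq (fun k => ln (INR (k + 2)) / INR (k + 2)) 0).
  { apply (is_lim_comp_seq (fun y => ln y / y) _ p_infty); [apply is_lim_div_ln_p| |exact Hinf].
    exists O. intros n _. discriminate. }
  (* In the logarithm of [vdc_base n] the terms of order [n ln n] cancel, leaving
     [(2 n - 1) ln 2 - n] with an error between 0 and [2 + 2 ln n]. *)
  apply is_lim_seq_le_le with
    (fun k => (2 * ln 2 - 1) + (- ln 2) * / INR (k + 2))
    (fun k => (2 * ln 2 - 1) + ((2 - ln 2) * / INR (k + 2) +
                                2 * (ln (INR (k + 2)) / INR (k + 2)))).
  - intros k. unfold l. rewrite vdc_base_SS. replace (k + 2)%nat with (S (S k)) by lia.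
    set (n := S (S k)). set (m := S k).
    assert (Hm : 1 <= INR m) by (unfold m; rewrite S_INR; pose proof (pos_INR k); lra).
    assert (En : INR n = INR m + 1) by apply S_INR.
    assert (Ek : INR k = INR m - 1) by (unfold m; rewrite S_INR; ring).
    assert (Hmk : 0 < INR m ^ k) by (apply pow_lt; lra).
    pose proof (INR_fact_lt_0 m) as Hf.
    assert (H2 : 0 < 2 ^ (2 * k + 3)) by (apply pow_lt; lra).
    rewrite ln_div by (try apply Rmult_lt_0_compat; assumption).
    rewrite ln_mult by assumption. rewrite !ln_pow by lra.
    rewrite plus_INR, mult_INR, Ek. replace (INR 3) with 3 by (simpl; ring).
    replace (INR 2) with 2 by (simpl; ring).
    pose proof (ln_fact_bounds k) as [L1 L2]. fold m in L1, L2.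
    assert (Hln0 : 0 <= ln (INR m)) by (rewrite <- ln_1; apply ln_le; lra).
    assert (Hlnn : ln (INR m) <= ln (INR n)) by (apply ln_le; lra).
    set (A := (2 * (INR m - 1) + 3) * ln 2 + ln (INR (fact m)) - (INR m - 1) * ln (INR m)).
    replace (2 * ln 2 - 1 + - ln 2 * / INR n)
      with (1 / INR n * ((2 * INR n - 1) * ln 2 - INR n)) by (field; lra).
    replace (2 * ln 2 - 1 + ((2 - ln 2) * / INR n + 2 * (ln (INR n) / INR n)))
      with (1 / INR n * ((2 * INR n - 1) * ln 2 - INR n + 2 + 2 * ln (INR n))) by (field; lra).
    assert (0 < 1 / INR n) by (apply Rdiv_lt_0_compat; lra).
    split; apply Rmult_le_compat_l; try lra; unfold A; rewrite En in *; lra.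
  - replace (Finite (2 * ln 2 - 1)) with (Finite (2 * ln 2 - 1 + - ln 2 * 0)) by (f_equal; ring).
    apply is_lim_seq_plus'; [apply is_lim_seq_const|].
    apply (is_lim_seq_scal_l _ (- ln 2) 0 Hinv).
  - replace (Finite (2 * ln 2 - 1)) with (Finite (2 * ln 2 - 1 + ((2 - ln 2) * 0 + 2 * 0)))
      by (f_equal; ring).
    apply is_lim_seq_plus'; [apply is_lim_seq_const|]. apply is_lim_seq_plus'.
    + apply (is_lim_seq_scal_l _ (2 - ln 2) 0 Hinv).
    + apply (is_lim_seq_scal_l _ 2 0 Hlog).
Qed.

Theorem lemma7 :
  exists K : nat -> R,
    (forall n : nat, (2 <= n)%nat -> K n <= Rpower 2 (5 / 3)) /\
    is_lim_seq K (4 / exp 1) /\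
    (forall (n : nat) (a b lambda : R) (f : R -> R),
       (2 <= n)%nat ->
       a < b ->
       n_times_differentiable_on n f a b ->
       0 < lambda ->
       (forall x : R, a < x < b -> Rabs (Derive_n f n x) >= lambda) ->
       ex_RInt (osc f) a b /\
       Cmod (RInt (osc f) a b) <= K n * (INR n / Rpower lambda (1 / INR n))).
Proof.
  exists vdc_constant. split; [|split; [exact vdc_constant_lim|]].
  { intros [|[|k]] Hn; try lia. apply vdc_constant_le. }
  intros n a b lambda f Hn Hab Hf Hl Hlam.
  destruct n as [|[|k]]; try lia.
  set (n := S (S k)) in *. set (B := vdc_constant n * (INR n / Rpower lambda (1 / INR n))).
  assert (Hn0 : 0 < INR n) by (apply lt_0_INR; lia).
  assert (HB : 0 < B).
  { apply Rmult_lt_0_compat; [apply exp_pos|]. apply Rdiv_lt_0_compat; [exact Hn0|apply exp_pos]. }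
  (* Raising to the power [n] removes both roots, leaving only natural powers for the
     optimization. *)
  assert (HBn : lambda * B ^ n = vdc_base n * INR n ^ n).
  { unfold B, vdc_constant, Rdiv at 2. rewrite !Rpow_mult_distr, pow_inv.
    rewrite !Rpower_inv_pow; [field; lra|exact Hl|lia|apply vdc_base_pos|lia]. }
  apply osc_RInt_bound; [lra|]. intros p q Hpq.
  set (al := 4 * INR (S k) * INR n / B).
  apply (osc_component_bound k (Derive_n f) a b p q al lambda B); auto.
  - intros j x Hj Hx. apply Derive_correct. apply (Hf (S j)); [lia|exact Hx].
  - intros x Hx. now apply Rge_le, Hlam.
  - apply Rdiv_lt_0_compat; [|exact HB]. apply Rmult_lt_0_compat; [|exact Hn0].
    apply Rmult_lt_0_compat; [lra|apply lt_0_INR; lia].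
  - intros L HL. now apply optimal_threshold.
Qed.
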